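(* Let $K$ be a field, let $n\ge3$, let $M$ be the Chinese monoid of rank $n$, and let $D$ be the tree of diagrams for $n$, with associated congruences $\rho(d)$ on $M$ for $d\in D$. For every leaf $d$ of $D$, the ideal $\mathcal{I}_{\rho(d)}$ of $K[M]$ is prime.
   Context: The Chinese monoid of rank $n$ is the monoid $M=\langle a_1,\dots,a_n\rangle$ defined by the relations $a_ja_ia_k=a_ja_ka_i=a_ka_ja_i$ for $i\le k\le j$; $K[M]$ is its monoid algebra. For a congruence $\eta$ on $M$, $\mathcal{I}_\eta$ is the ideal of $K[M]$ spanned over $K$ by $\{s-t: (s,t)\in\eta\}$. **The tree $D$.** A diagram is a collection of dots (a dot $a_s$ uses the single index $s$) and arcs (an arc $a_ya_x$, $x<y$, uses the two indices $x,y$) on $\{1,\dots,n\}$, each index being used at most once. The vertices of the finite tree $D$ are the following diagrams, built level by level. The root (level 0) is the empty diagram. The children of the root (level 1) are the $n-2$ single dots $a_s$, $s=2,\dots,n-1$, and the $n-1$ single arcs $a_sa_{s-1}$, $s=2,\dots,n$. In each non-root vertex the used indices form an interval $\{u,u+1,\dots,v\}$. A non-root vertex is a leaf (it has no children) if it contains an arc using index $1$ or index $n$. If a non-root vertex $d$ with used interval $\{u,\dots,v\}$ is not a leaf (then $1<u\le v<n$), its children are: (i) the diagram obtained by adding the arc $a_{v+1}a_{u-1}$; (ii) if the last step in the construction of $d$ was adding an arc: the diagram obtained by adding the dot $a_{v+1}$ (provided $v+1<n$) and the diagram obtained by adding the dot $a_{u-1}$ (provided $u-1>1$); (iii) if $d$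 is in level $\ge 2$ and the last step was adding a dot: if that dot was $a_v$, the diagram obtained by adding the dot $a_{v+1}$ (provided $v+1<n$); if that dot was $a_u$, the diagram obtained by adding the dot $a_{u-1}$ (provided $u-1>1$). (If $d$ is a single dot in level 1, its only child is the one in (i).) **The congruences $\rho(d)$.** Let $B=\langle p,q: qp=1\rangle$ be the bicyclic monoid, let $\mathbb{N}$ (nonnegative integers under addition) be written multiplicatively as $\langle g\rangle$, and $\mathbb{Z}$ as $\langle g,g^{-1}\rangle$. For an interval $\{u,\dots,v\}$ let $C_{u,v}$ be the monoid generated by the $a_i$ with $i<u$ or $i>v$, subject to the Chinese relations among these generators and the additional relations that $a_1,\dots,a_{u-1}$ commute with each other and $a_{v+1},\dots,a_n$ commute with each other (it is trivial if there are no generators). Let $d\in D$ be in level $r$, with branch $d_0$ (root), $d_1,\dots,d_r=d$ leading from the root to $d$. Put $C_0=M$, $S_0=\{1\}$, and for $t\ge1$ let $C_t=C_{u,v}$, where $\{u,\dots,v\}$ is the set of used indices of $d_t$. For $0\le t<r$: - if $d_{t+1}$ arises from $d_t$ by adding a dot $a_s$, put $S_{t+1}=\mathbb{N}\times S_t$ and let $\psi_t: C_t\to C_{t+1}\times \mathbb{N}$ be the homomorphism with $a_s\mapsto(1,g)$ and $a_l\mapsto(a_l,1)$ for $l\ne s$; - if $d_{t+1}$ arises from $d_t$ by adding an arc $a_ya_x$ ($x<y$), put $S_{t+1}=B\times\mathbb{Z}\times S_t$ and let $\psi_t:C_t\to C_{t+1}\times B\times\mathbb{Z}$ be the homomorphism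 with $a_x\mapsto(1,p,g)$, $a_y\mapsto(1,q,1)$, $a_l\mapsto(a_l,p,1)$ for $l<x$, $a_l\mapsto(a_l,q,1)$ for $l>y$. Let $\kappa_t=\psi_t\times \mathrm{id}: C_t\times S_t\to C_{t+1}\times S_{t+1}$. Then $\rho(\text{root})$ is the trivial congruence on $M$ and, for $r\ge1$, $\rho(d)$ is the kernel congruence of $\kappa_{r-1}\circ\dots\circ\kappa_0: M\to C_r\times S_r$. *)

(* Defs.v *)
From HB Require Import structures.
From mathcomp Require Import all_boot all_order all_algebra.
From mathcomp Require Import boolp zify.
From mathcomp.multinomials Require Import monalg.

Set Implicit Arguments.
Unset Strict Implicit.
Unset Printing Implicit Defensive.

Local Open Scope nat_scope.
Local Open Scope quotient_scope.
Local Open Scope group_scope.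

(* A presentation with generators the [x : A] satisfying [pgen]; a defining    *)
(* relation [s = t] only matters when all letters of [s] and [t] are           *)
(* generators.                                                                 *)
Record presentation (A : choiceType) := Presentation {
  pgen : pred A;
  prel : seq A -> seq A -> Prop }.

Section Presented.
Variables (A : choiceType) (P : presentation A).

Definition pword := seq {x : A | pgen P x}.

Inductive pcongr : pword -> pword -> Prop :=
| pcongr_rel s t : prel P (map val s) (map val t) -> pcongr s t
| pcongr_refl s : pcongr s s
| pcongr_sym s t : pcongr s t -> pcongr t s
| pcongr_trans s t w : pcongr s t -> pcongr t w -> pcongr s w
| pcongr_cat s s' t t' : pcongr s t -> pcongr s' t' -> pcongr (s ++ s') (t ++ t').

Definition pcongrb (s t : pword) : bool := `[< pcongr s t >].

Lemma pcongrb_refl : reflexive pcongrb.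
Proof. by move=> s; apply/asboolP; apply: pcongr_refl. Qed.
Lemma pcongrb_sym : symmetric pcongrb.
Proof. by move=> s t; apply/asboolP/asboolP; apply: pcongr_sym. Qed.
Lemma pcongrb_trans : transitive pcongrb.
Proof.
by move=> s t w /asboolP h1 /asboolP h2; apply/asboolP; apply: pcongr_trans h1 h2.
Qed.

Canonical pcongr_equiv := EquivRel pcongrb pcongrb_refl pcongrb_sym pcongrb_trans.

Definition presented : Type := {eq_quot pcongr_equiv}.
HB.instance Definition _ := Choice.on presented.
HB.instance Definition _ := Quotient.on presented.

Definition pclass (s : pword) : presented := \pi_presented s.

Lemma pclassP s t : pclass s = pclass t <-> pcongr s t.
Proof.
split=> [h|h].
  by apply/asboolP; apply/(@eqmodP _ pcongr_equiv).
by apply/(@eqmodP _ pcongr_equiv); apply/asboolP.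
Qed.

Lemma pclassK (x : presented) : pclass (repr x) = x.
Proof. exact: reprK. Qed.

Lemma pcongr_repr s : pcongr (repr (pclass s)) s.
Proof. by apply/pclassP; rewrite pclassK. Qed.

Definition pmul (x y : presented) : presented := pclass (repr x ++ repr y).

Lemma pmulE s t : pmul (pclass s) (pclass t) = pclass (s ++ t).
Proof. by apply/pclassP; apply: pcongr_cat; apply: pcongr_repr. Qed.

Lemma pmulA : associative pmul.
Proof.
move=> x y z; rewrite -[x]pclassK -[y]pclassK -[z]pclassK.
by rewrite !pmulE catA.
Qed.

Lemma pmul1 : left_id (pclass [::]) pmul.
Proof. by move=> x; rewrite -[x]pclassK pmulE. Qed.

Lemma pmulr1 : right_id (pclass [::]) pmul.
Proof. by move=> x; rewrite -[x]pclassK pmulE cats0. Qed.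

HB.instance Definition _ := isMonoid.Build presented pmulA pmul1 pmulr1.

(* The element of [presented] named by the label [x], with the junk value 1    *)
(* when [x] is not a generator.                                                *)
Definition pgenerator (x : A) : presented :=
  if insub x is Some g then pclass [:: g] else 1.

(* The homomorphism sending each generator [x] to [f x]; it is computed on a   *)
(* representative word, hence is a homomorphism exactly when [f] respects the  *)
(* defining relations (see [plift_morph]).                                     *)
Definition plift (N : monoidType) (f : A -> N) (x : presented) : N :=
  \prod_(g <- repr x) f (val g).

Definition prespects (N : monoidType) (f : A -> N) : Prop :=
  forall s t, all (pgen P) s -> all (pgen P) t -> prel P s t ->
    \prod_(x <- s) f x = \prod_(x <- t) f x.

Lemma plift_class (N : monoidType) (f : A -> N) : prespects f ->
  forall s, plift f (pclass s) = \prod_(g <- s) f (val g).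
Proof.
move=> hf s; rewrite /plift.
have hE s1 t1 : pcongr s1 t1 ->
    \prod_(g <- s1) f (val g) = \prod_(g <- t1) f (val g).
  elim=> // {s1 t1} [s1 t1 h|s1 t1 w _ -> _ ->|s1 s2 t1 t2 _ h1 _ h2] //.
    have hall (w : pword) : all (pgen P) (map val w).
      by apply/allP => _ /mapP[g _ ->]; apply: valP.
    by have := hf _ _ (hall s1) (hall t1) h; rewrite !big_map.
  by rewrite !big_cat /= h1 h2.
exact: hE (pcongr_repr s).
Qed.

Lemma plift_morph (N : monoidType) (f : A -> N) : prespects f ->
  monoid_morphism (plift f) /\
  (forall x, pgen P x -> plift f (pgenerator x) = f x).
Proof.
move=> hf; split; first split.
- by rewrite (plift_class hf [::]) big_nil.
- move=> x y; rewrite -[x]pclassK -[y]pclassK [_ * _]pmulE !plift_class //.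
  by rewrite big_cat.
- move=> x hx; rewrite /pgenerator insubT plift_class //.
  by rewrite big_cons big_nil mulg1.
Qed.

End Presented.

Inductive chinese_rel : seq nat -> seq nat -> Prop :=
| chinese_rel1 i k j : i <= k <= j -> chinese_rel [:: j; i; k] [:: j; k; i]
| chinese_rel2 i k j : i <= k <= j -> chinese_rel [:: j; k; i] [:: k; j; i].

(* Generators are labelled by their indices 1, ..., n. *)
Definition chinese_pres (n : nat) : presentation nat :=
  Presentation (fun i => 0 < i <= n) chinese_rel.

Definition chinese_monoid (n : nat) : Type := presented (chinese_pres n).
HB.instance Definition _ n := Monoid.on (chinese_monoid n).

Section ChineseMonom.
Variable n : nat.

Let one_nat : nat -> Algebra.to_multiplicative nat := fun _ => 1%N.

Lemma chinese_unit (x y : chinese_monoid n) : x * y = 1 -> x = 1 /\ y = 1.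
Proof.
have hf : prespects (chinese_pres n) one_nat.
  by move=> s t _ _ [] i k j _; rewrite !big_cons big_nil.
have [[len1 lenM] _] := plift_morph hf.
have len0 (z : chinese_monoid n) : plift one_nat z = 0%N :> nat -> z = 1.
  rewrite /plift => h; rewrite -(pclassK z).
  by case: (repr z) h => [|g s] //; rewrite big_cons.
move=> /(congr1 (plift one_nat)); rewrite lenM len1 => h.
have /eqP : (plift one_nat x + plift one_nat y = 0)%N by exact: h.
by rewrite addn_eq0 => /andP[/eqP hx /eqP hy]; split; apply: len0.
Qed.

HB.instance Definition _ := Choice_isMonomialDef.Build (chinese_monoid n)
  (@mulgA (chinese_monoid n)) (@mul1g (chinese_monoid n)) (@mulg1 (chinese_monoid n))
  chinese_unit.

End ChineseMonom.

Definition Cuv_rel (u v : nat) (s t : seq nat) : Prop :=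
  chinese_rel s t \/
  exists i j, [/\ (i < u) && (j < u) || (v < i) && (v < j),
                  s = [:: i; j] & t = [:: j; i]].

Definition Cuv_pres (n u v : nat) : presentation nat :=
  Presentation (fun i => (0 < i <= n) && ((i < u) || (v < i))) (Cuv_rel u v).

(* [true] stands for p and [false] for q. *)
Definition bicyclic_pres : presentation bool :=
  Presentation predT (fun s t => s = [:: false; true] /\ t = [::]).

Definition bicyclic : monoidType := presented bicyclic_pres.
Definition bic_p : bicyclic := pgenerator bicyclic_pres true.
Definition bic_q : bicyclic := pgenerator bicyclic_pres false.

Lemma bicyclic_qp : bic_q * bic_p = 1.
Proof.
rewrite /bic_q /bic_p /pgenerator !insubT [_ * _]pmulE.
by apply/pclassP; apply: pcongr_rel.
Qed.

Definition natM : monoidType := Algebra.to_multiplicative nat.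
Definition intM : monoidType := Algebra.to_multiplicative int.
Definition nat_g : natM := 1%N.
Definition int_g : intM := Posz 1.

(* [PDot s] is the dot a_s and [PArc x y], with x < y, is the arc a_y a_x. *)
Inductive piece := PDot of nat | PArc of nat & nat.

(* A vertex of the tree is given by its pieces in the order of construction,   *)
(* the last one added coming first, i.e. by the branch leading to it: the      *)
(* tails of [d] are the vertices d_r, ..., d_0 of that branch.                 *)
Definition diagram := seq piece.

Definition piece_idx (p : piece) : seq nat :=
  match p with PDot s => [:: s] | PArc x y => [:: x; y] end.

Definition used (d : diagram) : seq nat := flatten (map piece_idx d).

(* Endpoints u and v of the interval of used indices (0 for the root). *)
Definition lo (d : diagram) : nat :=
  if used d is i :: s then foldr minn i s else 0.
Definition hi (d : diagram) : nat := foldr maxn 0 (used d).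

Definition has_end_arc (n : nat) (d : diagram) : bool :=
  has (fun p => if p is PArc x y then (1%N \in [:: x; y]) || (n \in [:: x; y])
                else false) d.

Definition last_arc (d : diagram) : bool :=
  if d is PArc _ _ :: _ then true else false.

(* [d] is in level >= 2 and the last step of its construction added a_s. *)
Definition last_dot (d : diagram) (s : nat) : bool :=
  if d is PDot s' :: _ :: _ then s' == s else false.

Inductive child (n : nat) : diagram -> diagram -> Prop :=
| child_root_dot s : 1 < s < n -> child n [::] [:: PDot s]
| child_root_arc s : 1 < s <= n -> child n [::] [:: PArc s.-1 s]
| child_arc d : ~~ has_end_arc n d -> d <> [::] ->
    child n d (PArc (lo d).-1 (hi d).+1 :: d)
| child_arc_dotr d : ~~ has_end_arc n d -> last_arc d ->
    (hi d).+1 < n -> child n d (PDot (hi d).+1 :: d)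
| child_arc_dotl d : ~~ has_end_arc n d -> last_arc d ->
    1 < (lo d).-1 -> child n d (PDot (lo d).-1 :: d)
| child_dot_dotr d : ~~ has_end_arc n d -> last_dot d (hi d) ->
    (hi d).+1 < n -> child n d (PDot (hi d).+1 :: d)
| child_dot_dotl d : ~~ has_end_arc n d -> last_dot d (lo d) ->
    1 < (lo d).-1 -> child n d (PDot (lo d).-1 :: d).

Inductive vertex (n : nat) : diagram -> Prop :=
| vertex_root : vertex n [::]
| vertex_child d e : vertex n d -> child n d e -> vertex n e.

Definition leaf (n : nat) (d : diagram) : Prop := vertex n d /\ has_end_arc n d.

Lemma leafP n d : 2 < n -> vertex n d ->
  leaf n d <-> (forall e, ~ child n d e).
Proof.
move=> n3 hd; split=> [[_ h] e hde|h].
  by case: hde h => // d' /negbTE->.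
split=> //; apply/negPn/negP => hn.
case: d hd h hn => [|p d] hd h hn.
  by apply: (h [:: PDot 2]); apply: child_root_dot.
by apply: (h _ (child_arc hn _)).
Qed.

Definition stage (n : nat) (d : diagram) : presentation nat :=
  if d is [::] then chinese_pres n else Cuv_pres n (lo d) (hi d).

(* The factor by which S_t is enlarged when a piece is added. *)
Definition piece_monoid (p : piece) : monoidType :=
  match p with PDot _ => natM | PArc _ _ => (bicyclic * intM)%type end.

Lemma unit_mulA : associative (fun _ _ : unit => tt).
Proof. by []. Qed.
Lemma unit_mul1 : left_id tt (fun _ _ : unit => tt).
Proof. by case. Qed.
Lemma unit_mulr1 : right_id tt (fun _ _ : unit => tt).
Proof. by case. Qed.
HB.instance Definition _ := isMonoid.Build unit unit_mulA unit_mul1 unit_mulr1.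

Fixpoint Smon (d : diagram) : monoidType :=
  match d with
  | [::] => unit
  | p :: d' => (piece_monoid p * Smon d')%type
  end.

(* Image of the generator a_l of C_t. Generators of C_t other than a_x, a_y     *)
(* satisfy l < x or l > y, and [a l] is then a generator of C_{t+1}.           *)
Definition psi_gen (n : nat) (d : diagram) (p : piece) (l : nat) :
    presented (stage n (p :: d)) * piece_monoid p :=
  let a := pgenerator (stage n (p :: d)) in
  match p return _ * piece_monoid p with
  | PDot s => if l == s then (1, nat_g) else (a l, 1)
  | PArc x y =>
      if l == x then (1, (bic_p, int_g))
      else if l == y then (1, (bic_q, 1))
      else if l < x then (a l, (bic_p, 1))
      else (a l, (bic_q, 1))
  end.

Definition psi (n : nat) (d : diagram) (p : piece) :
    presented (stage n d) -> presented (stage n (p :: d)) * piece_monoid p :=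
  plift (psi_gen n d p).

Section PsiMorphism.

Lemma pgenerator_out (A : choiceType) (P : presentation A) x :
  ~~ pgen P x -> pgenerator P x = 1.
Proof. by move=> h; rewrite /pgenerator insubN. Qed.

Lemma pgenerator_rel (A : choiceType) (P : presentation A) s t :
  all (pgen P) s -> all (pgen P) t -> prel P s t ->
  \prod_(x <- s) pgenerator P x = \prod_(x <- t) pgenerator P x.
Proof.
have hE (w : seq A) : all (pgen P) w ->
    exists2 w' : pword P, map val w' = w &
      \prod_(x <- w) pgenerator P x = pclass w'.
  elim: w => [_|x w IH /= /andP[hx /IH[w' <- hw']]].
    by exists [::]; rewrite ?big_nil.
  exists (exist _ x hx :: w') => //.
  by rewrite big_cons hw' /pgenerator insubT [_ * _]pmulE.
move=> /hE[s' <- ->] /hE[t' <- ->] h.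
by apply/pclassP; apply: pcongr_rel.
Qed.

Variables (n u v : nat).
Let a := pgenerator (Cuv_pres n u v).

Lemma Cuv_comm i j :
  (i <= v) && (j <= v) || (u <= i) && (u <= j) -> a i * a j = a j * a i.
Proof.
rewrite /a => h.
have [gi|gi] := boolP (pgen (Cuv_pres n u v) i); last first.
  by rewrite (pgenerator_out gi) mul1g mulg1.
have [gj|gj] := boolP (pgen (Cuv_pres n u v) j); last first.
  by rewrite (pgenerator_out gj) mul1g mulg1.
have hr : prel (Cuv_pres n u v) [:: i; j] [:: j; i].
  right; exists i, j; split=> //.
  move: gi gj => /= /andP[_ gi] /andP[_ gj]; move: h gi gj.
  by case/orP => /andP[h1 h2]; rewrite !ltnNge h1 h2 /= ?orbF => -> ->;
    rewrite ?orbT.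
have := @pgenerator_rel _ (Cuv_pres n u v) [:: i; j] [:: j; i].
rewrite !big_cons !big_nil !mulg1; apply=> //.
  by rewrite /all gi gj.
by rewrite /all gi gj.
Qed.

Lemma Cuv_chinese i k j : i <= k <= j -> 0 < i -> j <= n ->
  a j * (a i * a k) = a j * (a k * a i) /\ a j * (a k * a i) = a k * (a j * a i).
Proof.
case/andP=> ik kj i0 jn.
have k0 := leq_trans i0 ik; have kn := leq_trans kj jn.
have j0 := leq_trans k0 kj; have iN := leq_trans ik kn.
have [gk|gk] := boolP (pgen (Cuv_pres n u v) k); last first.
  by rewrite /a (pgenerator_out gk) !mul1g mulg1.
have [gj|gj] := boolP (pgen (Cuv_pres n u v) j); last first.
  have jv : j <= v by move: gj; rewrite /= j0 jn /= negb_or -!leqNgt => /andP[].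
  have kv := leq_trans kj jv; have iv := leq_trans ik kv.
  by rewrite (Cuv_comm (i := i) (j := k)) ?iv ?kv // /a (pgenerator_out gj) !mul1g.
have [gi|gi] := boolP (pgen (Cuv_pres n u v) i); last first.
  have ui : u <= i by move: gi; rewrite /= i0 iN /= negb_or -!leqNgt => /andP[].
  have uk := leq_trans ui ik; have uj := leq_trans uk kj.
  by rewrite (Cuv_comm (i := k) (j := i)) ?ui ?uk ?orbT //
     /a (pgenerator_out gi) !mul1g !mulg1 -/a Cuv_comm ?uk ?uj ?orbT.
have hik : i <= k <= j by rewrite ik.
have h1 := @pgenerator_rel _ (Cuv_pres n u v) [:: j; i; k] [:: j; k; i].
have h2 := @pgenerator_rel _ (Cuv_pres n u v) [:: j; k; i] [:: k; j; i].
rewrite !big_cons !big_nil !mulg1 in h1 h2.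
have [e1 e2 e3] : [/\ all (pgen (Cuv_pres n u v)) [:: j; i; k],
    all (pgen (Cuv_pres n u v)) [:: j; k; i] &
    all (pgen (Cuv_pres n u v)) [:: k; j; i]] by rewrite /all gi gj gk.
by split; [apply: h1 | apply: h2] => //; left; constructor.
Qed.

End PsiMorphism.

Lemma foldr_minn i s : foldr minn i s <= i.
Proof. by elim: s => //= x s; lia. Qed.

Lemma lo_le_hi d : d <> [::] -> lo d <= hi d.
Proof.
case: d => [//|[s|x y] d _]; rewrite /lo /hi /used /=.
  by have := foldr_minn s (flatten (map piece_idx d)); lia.
by have := foldr_minn x (flatten (map piece_idx d)); lia.
Qed.

Lemma lo_cons p d : d <> [::] -> lo (p :: d) = minn (lo [:: p]) (lo d).
Proof.
have h i j s : foldr minn (minn i j) s = minn i (foldr minn j s).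
  by elim: s => //= x s ->; lia.
case: d => [//|q d _]; rewrite /lo /used /=.
have hC i j s : minn i (foldr minn j s) = minn j (foldr minn i s).
  by rewrite -!h minnC.
case: q => [s'|x' y']; case: p => [s|x y] /=; set w := flatten _.
- by rewrite hC.
- by have := hC s' x w; lia.
- by have := hC x' s w; lia.
- by have := hC x x' w; lia.
Qed.

Lemma hi_cons p d : hi (p :: d) = maxn (hi [:: p]) (hi d).
Proof. by case: p => [s|x y]; rewrite /hi /used /=; lia. Qed.

Definition step_ok (n : nat) (d : diagram) (p : piece) : Prop :=
  [/\ lo (p :: d) <= hi (p :: d),
      d <> [::] -> [/\ lo (p :: d) <= lo d, lo d <= hi d & hi d <= hi (p :: d)],
      forall l, pgen (stage n d) l ->
        pgen (stage n (p :: d)) l = (l \notin piece_idx p) &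
      if p is PArc x y then
        [/\ x < y, forall l, pgen (stage n d) l -> (l <= x) || (y <= l) &
            d <> [::] -> lo d <= x.+1 /\ y <= (hi d).+1]
      else True].

Lemma lo_hi_arc x y : x <= y ->
  (lo [:: PArc x y] = x) * (hi [:: PArc x y] = y).
Proof. by move=> h; rewrite /lo /hi /=; split; lia. Qed.

Lemma lo_hi_dot s : (lo [:: PDot s] = s) * (hi [:: PDot s] = s).
Proof. by rewrite /lo /hi /=; split; lia. Qed.

Lemma child_step_ok n d p : child n d (p :: d) -> step_ok n d p.
Proof.
have arc0 s : 1 < s -> step_ok n [::] (PArc s.-1 s).
  move=> hs; have hss : s.-1 <= s by lia.
  rewrite /step_ok /stage /= !lo_hi_arc //; split=> //.
    by move=> l; rewrite !inE; lia.
  by split=> //; [lia | move=> l; lia].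
have dot0 s : step_ok n [::] (PDot s).
  rewrite /step_ok /stage /= !lo_hi_dot; split=> //.
  by move=> l; rewrite !inE; lia.
have arcS d0 : d0 <> [::] -> step_ok n d0 (PArc (lo d0).-1 (hi d0).+1).
  move=> hd; have lh := lo_le_hi hd.
  rewrite /step_ok (lo_cons _ hd) hi_cons.
  have hh : (lo d0).-1 <= (hi d0).+1 by lia.
  rewrite !lo_hi_arc //.
  split; [lia | by move=> _; split; lia | |].
    move=> l; rewrite /stage (lo_cons _ hd) hi_cons !lo_hi_arc //.
    by case: d0 hd lh hh => // q d0 _; set u := lo _; set v := hi _; rewrite /= !inE; lia.
  split; [lia | | lia].
  by case: d0 hd lh hh => // q d0 _; set u := lo _; set v := hi _; move=> lh hh l /=; lia.
have dotS d0 s : d0 <> [::] -> s.+1 = lo d0 \/ s = (hi d0).+1 -> step_ok n d0 (PDot s).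
  move=> hd hs; have lh := lo_le_hi hd.
  rewrite /step_ok (lo_cons _ hd) hi_cons.
  rewrite !lo_hi_dot; split=> //; [lia | by move=> _; split; lia | ].
  move=> l; rewrite /stage (lo_cons _ hd) hi_cons !lo_hi_dot.
  by case: d0 hd lh hs => // q d0 _; set u := lo _; set v := hi _; rewrite /= !inE; lia.
move Ee: (p :: d) => e hde; case: hde Ee => {e}.
- by move=> s hs [->]; have := dot0 s.
- by move=> s /andP[hs _] [->]; have := arc0 _ hs.
- by move=> d0 _ hd [->]; have := arcS _ hd.
- move=> d0 _ hd _ [->]; refine (dotS _ _ _ _); [by case: d0 hd | by right].
- move=> d0 _ hd h [->]; refine (dotS _ _ _ _); [by case: d0 hd h | by left; lia].
- move=> d0 _ hd _ [->]; refine (dotS _ _ _ _); [by case: d0 hd | by right].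
- move=> d0 _ hd h [->]; refine (dotS _ _ _ _); [by case: d0 hd h | by left; lia].
Qed.

Lemma stage_gen n d l : pgen (stage n d) l -> 0 < l <= n.
Proof. by case: d => //= q d /andP[]. Qed.

Lemma natM_comm (x y : natM) : x * y = y * x.
Proof. exact: addnC. Qed.

Lemma intM_comm (x y : intM) : x * y = y * x.
Proof. exact: GRing.addrC. Qed.

Lemma comm_chinese (N : monoidType) (x y z : N) :
  (forall s t : N, s * t = t * s) ->
  z * (x * y) = z * (y * x) /\ z * (y * x) = y * (z * x).
Proof. by move=> C; rewrite (C x y) !mulgA (C y z). Qed.

(* The maps psi_t are the homomorphisms with the prescribed values. *)
Lemma psi_morph n d p : child n d (p :: d) ->
  monoid_morphism (@psi n d p) /\
  (forall l, pgen (stage n d) l ->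
     @psi n d p (pgenerator (stage n d) l) = psi_gen n d p l).
Proof.
move=> /child_step_ok [luv hd hgen harc]; apply: plift_morph.
set a := pgenerator (stage n (p :: d)).
pose E (l : nat) : piece_monoid p := (psi_gen n d p l).2.
have fE l : pgen (stage n d) l -> psi_gen n d p l = (a l, E l).
  move=> hl; rewrite /E /psi_gen; have := hgen l hl.
  case: p luv hd {hgen harc} @a @E => [s|x y] luv hd a E; rewrite /= !inE => hg.
    case: eqP hg => //= _ hg.
    by rewrite /a pgenerator_out //= hg.
  have [ex|nx] := eqVneq l x.
    by rewrite /a pgenerator_out //= hg ex eqxx.
  have [ey|ny] := eqVneq l y.
    by rewrite /a pgenerator_out //= hg ey eqxx orbT.
  by case: ifP.
have Earc : (match p return (nat -> piece_monoid p) -> Prop with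
    | PArc x y => fun E => forall l, pgen (stage n d) l ->
      (E l).1 = if l <= x then bic_p else bic_q
    | PDot _ => fun=> True end) E.
  rewrite /E; case: (p) harc => // x y [xy hxy _] l hl.
  have := hxy l hl; rewrite /psi_gen.
  case: eqVneq => [->|nx]; first by rewrite leqnn.
  case: eqVneq => [->|ny]; first by rewrite leqNgt xy.
  by rewrite leq_eqVlt (negbTE nx); case: ltnP.
have Echin i k j : i <= k <= j -> pgen (stage n d) i -> pgen (stage n d) k ->
    pgen (stage n d) j ->
    E j * (E i * E k) = E j * (E k * E i) /\ E j * (E k * E i) = E k * (E j * E i).
  move=> /andP[ik kj] gi gk gj; move: (E) Earc.
  case: (p) => [s E' _|x y E' hE']; first exact: comm_chinese natM_comm.
  have [c1 c2] := comm_chinese (E' i).2 (E' k).2 (E' j).2 intM_comm.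
  have [b1 b2] : (E' j).1 * ((E' i).1 * (E' k).1) = (E' j).1 * ((E' k).1 * (E' i).1) /\
      (E' j).1 * ((E' k).1 * (E' i).1) = (E' k).1 * ((E' j).1 * (E' i).1).
    rewrite !hE' //; case: (leqP k x) => kx; last first.
      rewrite [j <= x]leqNgt (leq_trans kx kj) /=; case: ifP => _ //.
      by rewrite bicyclic_qp mulg1 mulgA bicyclic_qp mul1g.
    rewrite (leq_trans ik kx); case: ifP => _ //.
    by rewrite !mulgA bicyclic_qp mul1g -mulgA bicyclic_qp mulg1.
  by split; apply/pair_equal_spec; split.
have Ecomm i j : d <> [::] ->
    (i < lo d) && (j < lo d) || (hi d < i) && (hi d < j) ->
    pgen (stage n d) i -> pgen (stage n d) j -> E i * E j = E j * E i.
  move=> dn hij gi gj; move: (E) Earc harc.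
  case: (p) => [s E' _ _|x y E' hE' [xy _ /(_ dn)[lx yh]]]; first exact: natM_comm.
  apply/pair_equal_spec; split; last exact: intM_comm.
  have := lo_le_hi dn; rewrite /= !hE' // => lh.
  case/orP: hij => /andP[hi' hj].
    by have [-> ->] : i <= x /\ j <= x by lia.
  by have [/negbTE -> /negbTE ->] : ~~ (i <= x) /\ ~~ (j <= x) by lia.
have achin i k j : i <= k <= j -> pgen (stage n d) i -> pgen (stage n d) k ->
    pgen (stage n d) j ->
    a j * (a i * a k) = a j * (a k * a i) /\ a j * (a k * a i) = a k * (a j * a i).
  move=> h /stage_gen/andP[gi _] _ /stage_gen/andP[_ gj].
  exact: Cuv_chinese.
have chin s t : all (pgen (stage n d)) s -> all (pgen (stage n d)) t ->
    chinese_rel s t -> \prod_(x <- s) psi_gen n d p x = \prod_(x <- t) psi_gen n d p x.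
  move=> + + h; case: h => i k j hikj /and4P[g1 g2 g3 _] _; rewrite !big_cons !big_nil !mulg1 !fE //.
    have [e1 e2] := achin _ _ _ hikj g2 g3 g1.
    have [e3 e4] := Echin _ _ _ hikj g2 g3 g1.
    by apply/pair_equal_spec; split.
  have [e1 e2] := achin _ _ _ hikj g3 g2 g1.
  have [e3 e4] := Echin _ _ _ hikj g3 g2 g1.
  by apply/pair_equal_spec; split.
move=> s t hs ht; case Ed: d => [|q d0]; rewrite -Ed.
  by move=> h; apply: chin => //; move: h; rewrite Ed.
have dn : d <> [::] by rewrite Ed.
have -> : prel (stage n d) = Cuv_rel (lo d) (hi d) by rewrite Ed.
case=> [|[i [j [hij es et]]]]; first exact: chin.
move: hs; rewrite es et /= => /and3P[gi gj _].
rewrite !big_cons !big_nil !mulg1 !fE //.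
apply/pair_equal_spec; split; last exact: Ecomm.
have [h1 h2 h3] := hd dn.
apply: Cuv_comm; lia.
Qed.

(* The composite kappa_{r-1} o ... o kappa_0, with values regrouped as an      *)
(* element of C_r x S_r.                                                       *)
Fixpoint kappa (n : nat) (d : diagram) :
    chinese_monoid n -> presented (stage n d) * Smon d :=
  match d return chinese_monoid n -> presented (stage n d) * Smon d with
  | [::] => fun m => (m, 1)
  | p :: d' => fun m =>
      let cs := kappa d' m in
      let ce := @psi n d' p cs.1 in
      (ce.1, (ce.2, cs.2))
  end.

Lemma kappa_morph n d : vertex n d -> monoid_morphism (@kappa n d).
Proof.
elim=> [|d0 e hd IH hde]; first by split=> // x y; congr (_, _).
have [p ep] : exists p, e = p :: d0 by case: hde => *; eexists.
move: hde; rewrite {e}ep => /psi_morph[[psi1 psiM] _].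
have [k1 kM] := IH.
by split=> [|x y]; rewrite /= ?k1 ?kM /= ?psi1 ?psiM.
Qed.

Definition rho (n : nat) (d : diagram) (s t : chinese_monoid n) : Prop :=
  kappa d s = kappa d t.

Local Open Scope ring_scope.

Definition congr_ideal (K : fieldType) (M : monomType) (eta : M -> M -> Prop)
    (x : {malg K[M]}) : Prop :=
  exists2 r : seq (K * (M * M)),
    (forall c, c \in r -> eta c.2.1 c.2.2) &
    x = \sum_(c <- r) c.1 *: (<< c.2.1 >> - << c.2.2 >>).

Definition two_sided_ideal (R : nzRingType) (I : R -> Prop) : Prop :=
  [/\ I 0,
      forall x y, I x -> I y -> I (x - y) &
      forall a x, I x -> I (a * x) /\ I (x * a)].

(* Primeness for two-sided ideals of a noncommutative ring: AB is contained in *)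
(* I only if A or B is. As I is closed under sums, AB is contained in I as     *)
(* soon as all products of elements of A and B are.                            *)
Definition prime_ideal (R : nzRingType) (I : R -> Prop) : Prop :=
  [/\ two_sided_ideal I,
      ~ I 1 &
      forall A B : R -> Prop, two_sided_ideal A -> two_sided_ideal B ->
        (forall a b, A a -> B b -> I (a * b)) ->
        (forall a, A a -> I a) \/ (forall b, B b -> I b)].

(* Main.v *)
(* At a leaf one of the two blocks of C_{u,v} is empty, so M/rho(d) embeds into
   a product of copies of B, one for each arc, with a commutative monoid F that
   counts occurrences of letters. B acts by shifts on a space V with basis
   e_0, e_1, ...; tensoring one copy of V for each arc with K[F], we let
   K[M/rho(d)] act faithfully by matrices over a polynomial ring, and I_rho(d)
   consists of the elements of K[M] acting by 0. Given a, b outside I_rho(d),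
   take a nonzero entry of a, in column J1 say, and a nonzero column of b. Since
   M contains p (up to F) and q for each of the nested arcs, some t in M sends
   the lexicographically largest basis vector occurring in that column of b to
   J1 and kills the others. Then a t b has an entry which is a product of nonzero
   polynomials. *)

From HB Require Import structures.
Require Import Defs.
From mathcomp Require Import all_boot all_algebra.
From mathcomp Require Import finmap boolp zify.
From mathcomp.multinomials Require Import mpoly monalg.

Set Implicit Arguments.
Unset Strict Implicit.
Unset Printing Implicit Defensive.

Import GRing.Theory.

Local Open Scope nat_scope.

(** * Bicyclic normal forms and the action of words on states *)

(* [(i, j)] stands for p^i q^j. *)
Definition bnf : Type := (nat * nat)%type.
HB.instance Definition _ := Choice.on bnf.

(** In p^i q^j p^k q^l the middle factor q^j p^k cancels to p^(k-j) or to q^(j-k). With truncated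
    subtraction one formula covers both cases. *)
Definition bnf_mul (a b : bnf) : bnf :=
  (a.1 + (b.1 - a.2), (a.2 - b.1) + b.2).

Lemma bnf_mulA : associative bnf_mul.
Proof. by move=> [a b] [c d] [e f]; rewrite /bnf_mul /=; congr (_, _); lia. Qed.

Lemma bnf_mul1 : left_id (0, 0) bnf_mul.
Proof. by move=> [a b]; rewrite /bnf_mul /=; congr (_, _); lia. Qed.

Lemma bnf_mulr1 : right_id (0, 0) bnf_mul.
Proof. by move=> [a b]; rewrite /bnf_mul /=; congr (_, _); lia. Qed.

HB.instance Definition _ := isMonoid.Build bnf bnf_mulA bnf_mul1 bnf_mulr1.

Lemma bnf_mulE (a b : bnf) :
  (a * b)%g = (a.1 + (b.1 - a.2), (a.2 - b.1) + b.2) :> bnf.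
Proof. by []. Qed.

(* The action of B on the basis e_0, e_1, ... with p e_m = e_(m+1),            *)
(* q e_(m+1) = e_m and q e_0 = 0; [None] stands for 0.                         *)
Definition bnf_act (b : bnf) (m : nat) : option nat :=
  if b.2 <= m then Some (m - b.2 + b.1) else None.

Lemma bnf_actM (a b : bnf) m :
  bnf_act (a * b)%g m = obind (bnf_act a) (bnf_act b m).
Proof.
rewrite bnf_mulE /bnf_act /=; case: (leqP b.2 m) => hb /=; last first.
  by case: ifP => //; lia.
by case: ifP => h1; case: ifP => h2 //; try (congr Some); lia.
Qed.

(** The elements sending e_j to e_i are the p^(i-t) q^(j-t) with t at most i and j. Those with t > 0
    are exactly the ones sending e_(j-1) to e_(i-1). *)
Lemma bnf_act_exact (b : bnf) (i j : nat) :
  (bnf_act b j == Some i) =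
  (b == (i, j)) || [&& 0 < j, 0 < i & bnf_act b j.-1 == Some i.-1].
Proof.
case: b => k l; rewrite /bnf_act /= xpair_eqE.
have noneE x : (None == Some x :> option nat) = false by [].
by case: (leqP l j) => h1; case: (leqP l j.-1) => h2;
  rewrite ?noneE ?(inj_eq Some_inj); lia.
Qed.

Lemma bnf_act_exact_disj (b : bnf) (i j : nat) :
  b == (i, j) -> [&& 0 < j, 0 < i & bnf_act b j.-1 == Some i.-1] = false.
Proof.
move=> /eqP->; rewrite /bnf_act /=; case: j => // j.
by rewrite /= ltnn andbF.
Qed.

(* The B-component of a_l at the arc a_y a_x: the indices strictly between x   *)
(* and y were used earlier in the branch, so these letters have become 1.      *)
Definition arc_letter (a : nat * nat) (l : nat) : bnf :=
  if l <= a.1 then (1, 0) : bnf else if a.2 <= l then (0, 1) else (1%g : bnf).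

Definition arc_nf (a : nat * nat) (w : seq nat) : bnf :=
  (\prod_(l <- w) arc_letter a l)%g.

Lemma arc_nf_cat a s t : arc_nf a (s ++ t) = (arc_nf a s * arc_nf a t)%g.
Proof. exact: big_cat. Qed.

Lemma arc_nf_inner a w : all (fun l => a.1 < l < a.2) w -> arc_nf a w = 1%g.
Proof.
move=> /allP h; rewrite /arc_nf big_seq big1 // => l /h /andP[h1 h2].
by rewrite /arc_letter leqNgt h1 leqNgt h2.
Qed.

Lemma arc_nf_low a l k : l <= a.1 -> arc_nf a (nseq k l) = (k, 0).
Proof.
move=> hl; rewrite /arc_nf; elim: k => [|k IH]; first by rewrite big_nil.
by rewrite big_cons IH /arc_letter hl bnf_mulE /=; congr (_, _); lia.
Qed.

Lemma arc_nf_high a l k : a.1 < l -> a.2 <= l -> arc_nf a (nseq k l) = (0, k).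
Proof.
move=> hl hr; rewrite /arc_nf; elim: k => [|k IH]; first by rewrite big_nil.
by rewrite big_cons IH /arc_letter leqNgt hl hr bnf_mulE /=; congr (_, _); lia.
Qed.

(* A state is a tensor product of basis vectors e_j, one for each arc. *)
Fixpoint act (A : seq (nat * nat)) (w J : seq nat) : option (seq nat) :=
  match A, J with
  | [::], [::] => Some [::]
  | a :: A', j :: J' =>
      if bnf_act (arc_nf a w) j is Some i then omap (cons i) (act A' w J')
      else None
  | _, _ => None
  end.

Lemma act_cat A s t J : act A (s ++ t) J = obind (act A s) (act A t J).
Proof.
elim: A J => [|a A IH] [|j J] //=.
rewrite arc_nf_cat bnf_actM IH.
case: (bnf_act (arc_nf a t) j) => //= i.
by case: (act A t J) => /= [H|]; case: (bnf_act _ i).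
Qed.

Lemma act_size A w J I : act A w J = Some I -> size J = size A /\ size I = size A.
Proof.
elim: A J I => [|a A IH] [|j J] I //=; first by case=> <-.
case: (bnf_act _ j) => //= i; case E: (act A w J) => [H|] //= [<-].
by have [-> /= ->] := IH _ _ E.
Qed.

Lemma act_cons_eq a A w j J i I :
  (act (a :: A) w (j :: J) == Some (i :: I)) =
  (bnf_act (arc_nf a w) j == Some i) && (act A w J == Some I).
Proof.
rewrite /=; case: (bnf_act _ j) => //= k; case: (act A w J) => [H|] /=.
  by rewrite !(inj_eq Some_inj) eqseq_cons.
by rewrite andbF.
Qed.

Lemma act_raise A l k J : size J = size A -> all (fun a => l <= a.1) A ->
  act A (nseq k l) J = Some (map (addn k) J).
Proof.
elim: A J => [|a A IH] [|j J] //= [hJ] /andP[ha hA].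
by rewrite arc_nf_low // /bnf_act /= IH // subn0 addnC.
Qed.

Lemma act_lower A l k J : size J = size A ->
    all (fun a => (a.1 < l) && (a.2 <= l)) A ->
  act A (nseq k l) (map (addn k) J) = Some J.
Proof.
elim: A J => [|a A IH] [|j J] //= [hJ] /andP[/andP[h1 h2] hA].
by rewrite arc_nf_high // /bnf_act /= leq_addr IH // addn0 addKn.
Qed.

(** * Nested arcs and the isolation of one state *)

Definition arc_ends (A : seq (nat * nat)) : seq nat :=
  flatten [seq [:: a.1; a.2] | a <- A].

(* Arcs are listed from the outermost to the innermost one. *)
Fixpoint nested (A : seq (nat * nat)) : bool :=
  if A is a :: A' then
    [&& a.1 < a.2, all (fun l => a.1 < l < a.2) (arc_ends A') & nested A']
  else true.

Lemma arc_ends_all (P : pred nat) A :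
  all P (arc_ends A) = all (fun a => P a.1 && P a.2) A.
Proof. by elim: A => //= a A <-; rewrite /arc_ends /= andbA. Qed.

Lemma bigmax_seq_attained (T : eqType) (F : T -> nat) (s : seq T) :
  s != [::] -> exists2 x, x \in s & F x = \max_(y <- s) F y.
Proof.
case: s => // x s _; elim: s x => [|y s IH] x.
  by exists x; rewrite ?mem_head // big_seq1.
have [z hz e] := IH y; rewrite big_cons -e.
have [_|_] := leqP (F z) (F x).
  by exists x => //; rewrite mem_head.
by exists z; rewrite // inE hz orbT.
Qed.

(* [H0] is the lexicographically largest element of [S]: a power of the outer  *)
(* a_y kills every state whose first coordinate is not maximal, and the letters*)
(* of the inner arcs do not change the first coordinate.                       *)
Lemma isolate A (S : seq (seq nat)) (J : seq nat) :
    nested A -> size J = size A -> S != [::] -> all (fun H => size H == size A) S ->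
  exists w H0, [/\ all (mem (arc_ends A)) w, H0 \in S, act A w H0 = Some J &
    forall H, H \in S -> H != H0 -> act A w H = None].
Proof.
elim: A S J => [|a A IH] S J /=.
  move=> _ /size0nil -> hS /allP hA; case: S hS hA => // H0 S _ hA.
  have h0 H : H \in H0 :: S -> H = [::] by move=> /hA /nilP.
  exists [::], [::]; split=> //; first by rewrite -{1}(h0 H0) ?mem_head.
  by move=> H /h0 ->.
case/and3P=> ha hin hA; case: J => // j J [hJ] hS /allP hSA.
pose m := \max_(H <- S) head 0 H.
(* The inner coordinates are shifted by j because the inductive word acts after a_x^j, which raises
   them along with the outer one. *)
pose S' := [seq map (addn j) (behead H) | H <- S & head 0 H == m].
have szS' : all (fun H => size H == size A) S'.
  apply/allP => G /mapP[H]; rewrite mem_filter => /andP[_ /hSA /eqP hH] {G}->.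
  by rewrite size_map size_behead hH.
have [Hm HmS hm] := bigmax_seq_attained (head 0) hS.
have nS' : S' != [::].
  rewrite -size_eq0 size_map size_filter -lt0n -has_count.
  by apply/hasP; exists Hm; rewrite ?hm.
have [w [H' [hw H'S wH' wH]]] := IH S' J hA hJ nS' szS'.
have [H0 H0S eH'] : exists2 H, H \in [seq H <- S | head 0 H == m] &
    H' = map (addn j) (behead H) by exact/mapP.
(* Raising the inner coordinates first keeps the power of the outer a_y from   *)
(* killing a state through them.                                               *)
pose up := if A is b :: _ then nseq m b.1 else [::].
have innerw : all (fun l => a.1 < l < a.2) w.
  by apply/allP => l /(allP hw) /(allP hin).
have inner_up : all (fun l => a.1 < l < a.2) up.
  rewrite /up; case: (A) hin => // b A' /= /andP[hb _].
  by rewrite all_nseq hb orbT.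
have act_up G : size G = size A -> act A up G = Some (map (addn m) G).
  rewrite /up; case: (A) hA => [_ /size0nil ->|b A' hA' hG] //.
  apply: act_raise => //=; rewrite leqnn /=.
  move: hA' => /= /and3P[_ + _]; rewrite arc_ends_all => /allP h.
  by apply/allP => c /h /andP[/andP[/ltnW]].
have out_lo : all (fun b => a.1 <= b.1) A.
  move: hin; rewrite arc_ends_all => /allP h.
  by apply/allP => b /h /andP[/andP[/ltnW]].
have out_hi : all (fun b => (b.1 < a.2) && (b.2 <= a.2)) A.
  move: hin; rewrite arc_ends_all => /allP h.
  by apply/allP => b /h /andP[/andP[_ ->] /andP[_ /ltnW]].
(* The word acts from right to left: [up] adds m to the inner coordinates, a_y^m subtracts m from
   all of them and kills h < m, a_x^j adds j everywhere, and [w] moves only the inner ones. *)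
have actE h G : size G = size A ->
    act (a :: A) (w ++ nseq j a.1 ++ nseq m a.2 ++ up) (h :: G) =
    if m <= h then omap (cons (h - m + j)) (act A w (map (addn j) G)) else None.
  move=> hG; rewrite [in LHS]/= !arc_nf_cat !(arc_nf_inner innerw)
    !(arc_nf_inner inner_up) arc_nf_low // arc_nf_high // mul1g mulg1.
  rewrite !act_cat act_up //= act_lower //= act_raise //=.
  by rewrite bnf_mulE /bnf_act /= subnn addn0 add0n; case: leqP.
pose W := w ++ nseq j a.1 ++ nseq m a.2 ++ up; rewrite -/W in actE.
exists W, H0.
move: H0S; rewrite mem_filter => /andP[/eqP hd0 H0S].
have destr H : H \in S -> exists h G, [/\ H = h :: G, size G = size A & h <= m].
  move=> HS; have /eqP := hSA _ HS; case: H HS => // h G HS [hG].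
  by exists h, G; split=> //; exact: (leq_bigmax_seq (F := head 0) _ HS).
split=> //.
- rewrite /W !all_cat !all_nseq /arc_ends /= !inE !eqxx !orbT /=.
  apply/andP; split.
    by apply/allP => l /(allP hw) /= hl; rewrite !inE [_ \in _]hl !orbT.
  rewrite /up; case: (A) => // b A' /=.
  by rewrite all_nseq /= !inE eqxx !orbT.
- have [h [G [e hG _]]] := destr _ H0S; rewrite e.
  change (act (a :: A) W (h :: G) = Some (j :: J)); rewrite actE //.
  move: hd0 eH' wH'; rewrite e [head _ _]/= [behead _]/= => -> -> ->.
  by rewrite leqnn subnn.
move=> H HS nH; have [h [G [e hG hle]]] := destr _ HS; rewrite e.
change (act (a :: A) W (h :: G) = None); rewrite actE //.
case: leqP => // hm2.
have eh : h = m by apply/eqP; rewrite eqn_leq hle hm2.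
rewrite wH //.
  by apply/mapP; exists H; rewrite ?mem_filter ?e //= eh eqxx -eh -e HS.
apply: contraNneq nH; rewrite eH' => /(inj_map (@addnI j)) eG.
have [h0 [G0 [e0 _ _]]] := destr _ H0S.
by move: hd0 eG; rewrite e e0 /= => -> ->; rewrite eh.
Qed.
Local Open Scope group_scope.

(** * Combinatorial description of the congruence of a leaf *)

Lemma prod_pairE (N1 N2 : monoidType) (F : nat -> N1) (G : nat -> N2) s :
  \prod_(l <- s) ((F l, G l) : (N1 * N2)%type) =
  (\prod_(l <- s) F l, \prod_(l <- s) G l).
Proof. by elim: s => [|l s IH]; rewrite ?big_nil // !big_cons IH. Qed.

Definition bic_letter (a : nat * nat) (l : nat) : bicyclic :=
  if l <= a.1 then bic_p else if a.2 <= l then bic_q else 1.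

Definition bic_of (b : bnf) : bicyclic := bic_p ^+ b.1 * bic_q ^+ b.2.

Lemma bic_of_letterM a l b : bic_of (arc_letter a l * b) = bic_letter a l * bic_of b.
Proof.
case: b => i j; rewrite bnf_mulE /arc_letter /bic_letter /bic_of.
case: ifP => _ /=; first by rewrite subn0 add0n add1n expgS mulgA.
case: ifP => _ /=; last by rewrite subn0 !add0n mul1g.
case: i => [|i]; first by rewrite add0n subn0 add1n expgS !mul1g.
by rewrite subn1 /= add0n expgS !mulgA bicyclic_qp mul1g.
Qed.

Lemma bic_of_arc_nf a w : \prod_(l <- w) bic_letter a l = bic_of (arc_nf a w).
Proof.
rewrite /arc_nf; elim: w => [|l w IH].
  by rewrite !big_nil /bic_of /= mulg1.
by rewrite !big_cons bic_of_letterM IH.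
Qed.

Definition bnf_letter (b : bool) : bnf := if b then (1, 0)%N else (0, 1)%N.

Lemma bnf_letter_respects : prespects bicyclic_pres bnf_letter.
Proof. by move=> s t _ _ [-> ->]; rewrite !big_cons !big_nil. Qed.

(** Normal forms in B are unique: [bnf] satisfies qp = 1, so B maps to it and equal products have
    equal normal forms. *)
Lemma bic_letterE a w w' :
  (\prod_(l <- w) bic_letter a l == \prod_(l <- w') bic_letter a l) =
  (arc_nf a w == arc_nf a w').
Proof.
apply/eqP/eqP => [|e]; last by rewrite !bic_of_arc_nf e.
have [[f1 fM] fg] := plift_morph bnf_letter_respects.
have hw v : plift bnf_letter (\prod_(l <- v) bic_letter a l) = arc_nf a v.
  rewrite /arc_nf; elim: v => [|l v IH]; first by rewrite !big_nil.
  rewrite !big_cons fM IH; congr (_ * _); rewrite /bic_letter /arc_letter.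
  by case: ifP => _; [|case: ifP => _]; rewrite ?f1 // fg.
by move=> /(congr1 (plift bnf_letter)); rewrite !hw.
Qed.

Lemma nat_letterE (s : nat) (w : seq nat) :
  \prod_(l <- w) (if l == s then nat_g else 1) = count_mem s w :> natM.
Proof.
elim: w => [|l w IH]; first by rewrite big_nil.
by rewrite big_cons IH /=; case: eqP.
Qed.

Lemma int_letterE (s : nat) (w : seq nat) :
  \prod_(l <- w) (if l == s then int_g else 1) = Posz (count_mem s w) :> intM.
Proof.
elim: w => [|l w IH]; first by rewrite big_nil.
by rewrite big_cons IH /=; case: eqP.
Qed.

(** Defined on all labels: letters used up earlier in a branch get the value 1, so words need not be
    filtered from stage to stage. *)
Definition piece_gen (p : piece) : nat -> piece_monoid p :=
  match p return nat -> piece_monoid p with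
  | PDot s => fun l => if l == s then nat_g else 1
  | PArc x y => fun l => (bic_letter (x, y) l, if l == x then int_g else 1)
  end.

Fixpoint sgen (d : diagram) : nat -> Smon d :=
  match d return nat -> Smon d with
  | [::] => fun=> tt
  | p :: d' => fun l => (piece_gen p l, sgen d' l)
  end.

Definition arcs (d : diagram) : seq (nat * nat) :=
  pmap (fun p => if p is PArc x y then Some (x, y) else None) d.

(** An arc contributes only its lower index, since only a_x has a nontrivial component in the
    infinite cyclic factor. *)
Definition keys (d : diagram) : seq nat :=
  map (fun p => match p with PDot s => s | PArc x _ => x end) d.

Definition same_data (A : seq (nat * nat)) (k w w' : seq nat) : bool :=
  all (fun a => arc_nf a w == arc_nf a w') A &&
  all (fun l => count_mem l w == count_mem l w') k.

Lemma sgenE d w w' :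
  \prod_(l <- w) sgen d l = \prod_(l <- w') sgen d l <->
  same_data (arcs d) (keys d) w w'.
Proof.
elim: d => [|p d IH] /=.
  by split=> // _; case: (\prod_(l <- w) _); case: (\prod_(l <- w') _).
rewrite !prod_pairE pair_equal_spec IH; case: p => [s|x y] /=.
  rewrite !nat_letterE /same_data /=; split=> [[-> /andP[-> ->]]|].
    by rewrite eqxx.
  by case/and3P=> -> /eqP-> ->.
rewrite !prod_pairE pair_equal_spec !int_letterE /same_data /= -bic_letterE.
split=> [[[-> [->]] /andP[-> ->]]|]; first by rewrite !eqxx.
by case/andP=> /andP[/eqP-> ->] /andP[/eqP-> ->].
Qed.

(** * Index ranges along a branch and the map [kappa] on words *)

Lemma vertex_cons n p d : vertex n (p :: d) -> vertex n d /\ child n d (p :: d).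
Proof.
move E: (p :: d) => e h; case: h E => // d0 e' hd0 hc E.
have e0 : d0 = d by case: hc E => // [s|s|d1|d1|d1|d1|d1] _ // *; congruence.
by subst d0; rewrite -?E in hc *; subst e'.
Qed.

Lemma used_range d i : i \in used d -> lo d <= i <= hi d.
Proof.
have hm j s : i \in s -> foldr minn j s <= i.
  by elim: s => //= x s IH; rewrite inE => /orP[/eqP->|/IH]; lia.
have hM s : i \in s -> i <= foldr maxn 0 s.
  by elim: s => //= x s IH; rewrite inE => /orP[/eqP->|/IH]; lia.
move=> hi_; rewrite /hi hM // andbT.
move: hi_; rewrite /lo; case: (used d) => // j s; rewrite inE.
by case/orP=> [/eqP->|/hm//]; apply: foldr_minn.
Qed.

(** The strict bounds for vertices without an end arc carry the induction: they leave room for the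
    next indices lo - 1 and hi + 1. *)
Lemma vertex_range n d : vertex n d -> d <> [::] ->
  0 < lo d /\ hi d <= n /\ (~~ has_end_arc n d -> 1 < lo d /\ hi d < n).
Proof.
have arcE x y d0 : ~~ has_end_arc n (PArc x y :: d0) -> x != 1%N /\ y != n.
  by rewrite /has_end_arc /= !inE !negb_or => /andP[]; lia.
elim=> // d0 e hd IH hc _; case: hc IH hd => //.
- by move=> s hs _ _; rewrite !lo_hi_dot; lia.
- move=> s hs _ _; have hss : s.-1 <= s by lia.
  by rewrite !lo_hi_arc //; split; [|split; [|move=> /arcE]]; lia.
- move=> d1 he hd1 /(_ hd1)[h1 [h2 /(_ he)[h3 h4]]] _.
  have lh := lo_le_hi hd1; have hh : (lo d1).-1 <= (hi d1).+1 by lia.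
  rewrite (lo_cons _ hd1) hi_cons !lo_hi_arc //.
  by split; [|split; [|move=> /arcE]]; lia.
all: move=> d1 he hl hn IH _; have hd1 : d1 <> [::] by case: (d1) hl.
all: have [h1 [h2 /(_ he)[h3 h4]]] := IH hd1; have lh := lo_le_hi hd1.
all: by rewrite (lo_cons _ hd1) hi_cons !lo_hi_dot; lia.
Qed.

Lemma vertex_inside n d p l : vertex n (p :: d) -> d <> [::] ->
  lo d <= l <= hi d ->
  match p with PDot s => l != s | PArc x y => x < l < y end.
Proof.
case/vertex_cons=> hd hc hd0; have [h0 [_ he]] := vertex_range hd hd0.
move E: (p :: d) hc => e hc; case: hc E hd0 hd h0 he =>
  [s _|s _|d1 h hd1|d1 h hl hn|d1 h hl hn|d1 h hl hn|d1 h hl hn] [->] //.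
all: by move=> hd0 _ h0 /(_ h)[h1 h2]; lia.
Qed.

Lemma psi_genE n d p l : step_ok n d p -> pgen (stage n d) l ->
  psi_gen n d p l = (pgenerator (stage n (p :: d)) l, piece_gen p l).
Proof.
case=> _ _ hgen harc hl; have := hgen l hl.
rewrite /psi_gen; case: p hgen harc => [s|x y] hgen harc;
  rewrite [piece_idx _]/= !inE => hg.
  case: eqVneq hg => [->|nx] hg; last by rewrite /= (negbTE nx).
  by rewrite pgenerator_out ?hg //= eqxx.
case: harc => xy hxy _; have := hxy l hl; rewrite /piece_gen /bic_letter /=.
case: eqVneq hg => [->|nx] hg; first by rewrite leqnn pgenerator_out ?hg.
case: eqVneq hg => [->|ny] hg.
  by rewrite leqNgt xy leqnn /= pgenerator_out ?hg // eqxx.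
by rewrite ltn_neqAle nx /=; case: leqP => //= _ ->.
Qed.

Lemma kappa_gen n d l : vertex n d -> 0 < l <= n ->
  kappa d (pgenerator (chinese_pres n) l) = (pgenerator (stage n d) l, sgen d l).
Proof.
elim: d => [|p d IH] //= hv hl; have [hd hc] := vertex_cons hv.
rewrite IH //=; have [[psi1 psiM] psig] := psi_morph hc.
have hs := child_step_ok hc.
have [gl|gl] := boolP (pgen (stage n d) l); first by rewrite psig // psi_genE.
(* Here l was used earlier and is already 1 in C_t. It lies strictly inside the new arc, or differs
   from the new dot, so [piece_gen] is 1 there too. *)
have dn : d <> [::] by case: (d) gl => //=; rewrite hl.
have inl : lo d <= l <= hi d.
  case: (d) dn gl => // q d0 _ /=; rewrite hl /= negb_or -!leqNgt.
  by move=> /andP[-> ->].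
rewrite (pgenerator_out gl) psi1.
have := vertex_inside hv dn inl; case: hs => _ /(_ dn)[h1 h2 h3] _ _ hp.
rewrite pgenerator_out /=; last by rewrite hl /=; lia.
case: p hp {hv hc psi1 psiM psig h1 h3} => [s|x y] /=; first by move/negbTE->.
case/andP=> h1 h3; rewrite /bic_letter /= leqNgt h1 leqNgt h3 /=.
by rewrite gtn_eqF.
Qed.

Lemma kappa_pclass n d (s : pword (chinese_pres n)) : vertex n d ->
  kappa d (pclass s) = (\prod_(l <- map val s) pgenerator (stage n d) l,
                        \prod_(l <- map val s) sgen d l).
Proof.
move=> hv; have [k1 kM] := kappa_morph hv; rewrite -prod_pairE.
elim: s => [|g s IH] /=; first by rewrite big_nil.
rewrite big_cons -IH -(pmulE [:: g] s).
have -> : pclass [:: g] = pgenerator (chinese_pres n) (val g).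
  by rewrite /pgenerator valK.
by rewrite [kappa d _]kM kappa_gen //; apply: (valP g).
Qed.

Lemma prod_perm_commute (N : monoidType) (F : nat -> N) (s t : seq nat) :
  (forall i j, i \in s -> j \in s -> F i * F j = F j * F i) ->
  perm_eq s t -> \prod_(l <- s) F l = \prod_(l <- t) F l.
Proof.
elim: s t => [|x s IH] t hC; first by rewrite perm_sym => /perm_nilP->.
move=> hst; have xt : x \in t by rewrite -(perm_mem hst) mem_head.
case/splitPr: xt hst => t1 t2 hst.
have hst' : perm_eq s (t1 ++ t2).
  by rewrite -(perm_cons x) (permPl hst) perm_catC /= perm_cons perm_catC.
rewrite big_cons (IH _ _ hst'); last first.
  by move=> i j hi hj; apply: hC; rewrite inE ?hi ?hj orbT.
rewrite !big_cat big_cons /= !mulgA; congr (_ * _).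
have : {subset t1 <= x :: s}.
  by move=> i hi; rewrite (perm_mem hst) mem_cat hi.
elim: t1 {hst hst'} => [|y t1 IH1] h; first by rewrite big_nil mul1g mulg1.
rewrite big_cons mulgA hC ?mem_head ?h ?mem_head // -!mulgA IH1 //.
by move=> i hi; apply: h; rewrite inE hi orbT.
Qed.

(* If one of the two blocks of generators is empty, C_{u,v} is free commutative. *)
Lemma stage_prodE n u v w w' : (u <= 1) || (n <= v) ->
  \prod_(l <- w) pgenerator (Cuv_pres n u v) l =
    \prod_(l <- w') pgenerator (Cuv_pres n u v) l <->
  forall l, pgen (Cuv_pres n u v) l -> count_mem l w = count_mem l w'.
Proof.
move=> huv; set P := Cuv_pres n u v; split=> [e l hl|h].
  (* All defining relations permute letters, so counting one letter is a homomorphism. *)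
  pose f (k : nat) : natM := if k == l then nat_g else 1.
  have hf : prespects P f.
    have fC (x y : natM) : x * y = y * x by exact: natM_comm.
    move=> s t _ _ [[i k j _|i k j _]|[i [j [_ -> ->]]]];
      rewrite !big_cons !big_nil !mulg1.
    - by rewrite (fC (f i)).
    - by rewrite !mulgA (fC (f j)).
    - exact: fC.
  have [[f1 fM] fg] := plift_morph hf.
  have hv v0 : plift f (\prod_(k <- v0) pgenerator P k) = count_mem l v0.
    rewrite -[RHS]nat_letterE; elim: v0 => [|k v0 IH]; first by rewrite !big_nil.
    rewrite !big_cons fM IH; congr (_ * _).
    have [gk|gk] := boolP (pgen P k); first by rewrite fg.
    rewrite pgenerator_out // f1; case: eqP => // ekl.
    by move: gk; rewrite ekl hl.
  by have := congr1 (plift f) e; rewrite !hv.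
have flt v0 : \prod_(l <- v0) pgenerator P l =
    \prod_(l <- [seq l <- v0 | pgen P l]) pgenerator P l.
  rewrite big_filter [RHS]big_mkcond; apply: eq_bigr => l _.
  by case: ifPn => // /pgenerator_out.
rewrite (flt w) (flt w'); apply: prod_perm_commute.
  move=> i j; rewrite !mem_filter.
  move=> /andP[/= /andP[hi hi'] _] /andP[/= /andP[hj hj'] _].
  by apply: Cuv_comm; lia.
apply/allP => l _ /=; rewrite !count_filter.
have [gl|gl] := boolP (pgen P l).
  have eqc v0 : count (predI (pred1 l) (pgen P)) v0 = count_mem l v0.
    by apply: eq_count => k /=; case: eqP => //= ->.
  by rewrite !eqc h.
have eqc v0 : count (predI (pred1 l) (pgen P)) v0 = 0.
  rewrite -(count_pred0 v0); apply: eq_count => k /=; case: eqP => //= ->.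
  exact: negbTE.
by rewrite !eqc.
Qed.

(* The letters whose number of occurrences is recorded by [kappa]; the upper   *)
(* ends of arcs are not among them.                                            *)
Definition counted n (d : diagram) (l : nat) : bool :=
  (l \in keys d) || pgen (stage n d) l.

Definition counted_letters n (d : diagram) : seq nat :=
  [seq l <- iota 1 n | counted n d l].

Lemma has_end_arc_lo_hi n d : has_end_arc n d -> (lo d <= 1) || (n <= hi d).
Proof.
rewrite /has_end_arc => h.
have : (1%N \in used d) || (n \in used d).
  elim: d h => //= -[s|x y] d IH; rewrite /used /=.
    by move/IH; rewrite /used !inE => /orP[]->; rewrite ?orbT.
  rewrite /= !inE => /orP[/orP[]/orP[]->|/IH]; rewrite ?orbT //.
  by rewrite /used => /orP[]->; rewrite ?orbT.
by case/orP=> /used_range; lia.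
Qed.

(** S_r records the bicyclic normal forms and the counts of the keys. At a leaf C_r is free
    commutative and records the counts of its own generators. *)
Lemma rhoE n d (s t : pword (chinese_pres n)) : leaf n d ->
  @rho n d (pclass s) (pclass t) <->
  same_data (arcs d) (counted_letters n d) (map val s) (map val t).
Proof.
case=> hv he; rewrite /rho !kappa_pclass // pair_equal_spec sgenE.
have [p [d' ed]] : exists p d', d = p :: d'.
  by case: (d) he => // p d' _; exists p, d'.
have -> : stage n d = Cuv_pres n (lo d) (hi d) by rewrite ed.
rewrite stage_prodE ?has_end_arc_lo_hi // -/(stage n _).
have hst l : pgen (Cuv_pres n (lo d) (hi d)) l = pgen (stage n d) l by rewrite ed.
have kin l : l \in keys d -> 0 < l <= n.
  have dn : d <> [::] by rewrite ed.
  have [h0 [h1 _]] := vertex_range hv dn; move=> hl.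
  have : l \in used d.
    elim: (d) hl => //= q e IH; rewrite inE /used /= mem_cat => /orP[/eqP->|/IH].
      by case: q => *; rewrite /= !inE eqxx.
    by rewrite /used => ->; rewrite orbT.
  by move/used_range; lia.
rewrite /same_data; split=> [[h1 /andP[-> /allP h2]]|/andP[-> /allP h]].
  apply/allP => l; rewrite mem_filter => /andP[/orP[/h2 //|hl] _].
  by rewrite h1 ?hst.
split=> [l hl|]; last first.
  apply/allP => l hl; apply: h; rewrite mem_filter /counted hl mem_iota /=.
  by have := kin _ hl; lia.
have hl' := stage_gen (etrans (esym (hst l)) hl).
apply/eqP/h; rewrite mem_filter /counted -hst hl orbT mem_iota.
by move: hl'; lia.
Qed.

Lemma arc_ends_used d l : l \in arc_ends (arcs d) -> l \in used d.
Proof.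
elim: d => //= -[s|x y] d IH; rewrite /arc_ends /used /=.
  by move/IH => h; rewrite inE [_ \in flatten _]h orbT.
rewrite !inE => /orP[->//|/orP[->|/IH h]]; rewrite ?orbT //.
by rewrite [_ \in flatten _]h !orbT.
Qed.

(** The last piece comes first in a diagram, and each arc encloses all indices used before it. *)
Lemma nested_arcs n d : vertex n d -> nested (arcs d).
Proof.
elim: d => //= p d IH hv; have [hd hc] := vertex_cons hv.
case: p hv hc => [s|x y] hv hc /=; first exact: IH.
have [_ _ _ [xy _ _]] := child_step_ok hc.
rewrite xy IH // andbT; apply/allP => l /arc_ends_used hl.
have dn : d <> [::] by case: (d) hl.
exact: (vertex_inside hv dn (used_range hl)).
Qed.

Lemma arc_ends_range n d l : vertex n d -> l \in arc_ends (arcs d) -> 0 < l <= n.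
Proof.
move=> hv hl; have dn : d <> [::] by case: (d) hl.
have [h0 [h1 _]] := vertex_range hv dn.
by have := used_range (arc_ends_used hl); lia.
Qed.
Local Close Scope group_scope.
Local Open Scope ring_scope.

(** * Primeness from a partial action *)

Lemma malgU_scale (T : choiceType) (F : nzRingType) (c : F) (k : T) :
  c *: << k >> = << c *g k >> :> {malg F[T]}.
Proof. by apply/malgP => l; rewrite mcoeffZ !mcoeffU mulrnAr mulr1. Qed.

Section PartialAction.
Variables (K : fieldType) (R : idomainType) (M : monomType) (X : choiceType).
Variables (C : {rmorphism K -> R}) (chi : M -> R) (ac : M -> X -> option X).
Hypothesis chiM : forall x y, chi (mmul x y) = chi x * chi y.
Hypothesis chi_neq0 : forall x, chi x != 0.
Hypothesis acM : forall x y J, ac (mmul x y) J = obind (ac x) (ac y J).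

Definition entry_coef (J I : X) (m : M) : R := if ac m J == Some I then chi m else 0.

(* The (I, J) entry of the matrix by which [x] acts on the free R-module on X, *)
(* [m] sending the basis vector J to [chi m] times [ac m J], or to 0.          *)
Definition entry (J I : X) : {malg K[M]} -> R := mmap C (entry_coef J I).

Lemma entryU J I (m : M) : entry J I << m >> = entry_coef J I m.
Proof. by rewrite /entry mmapU /= rmorph1 mul1r. Qed.

Lemma entryZU J I c (m : M) : entry J I (c *: << m >>) = C c * entry_coef J I m.
Proof. by rewrite malgU_scale /entry mmapU. Qed.

(** This is the matrix product. As X may be infinite, the sum runs over a finite S containing every
    state that the support of y reaches from J. *)
Lemma entryM (S : seq X) J I (x y : {malg K[M]}) : uniq S ->
    (forall m H, m \in msupp y -> ac m J = Some H -> H \in S) ->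
  entry J I (x * y) = \sum_(H <- S) entry H I x * entry J H y.
Proof.
move=> uS hS; rewrite malgME /entry raddf_sum.
under [RHS]eq_bigr do rewrite /mmap mulr_suml.
rewrite exchange_big /=; apply: eq_bigr => m _.
under [RHS]eq_bigr do rewrite mulr_sumr.
rewrite exchange_big raddf_sum /= big_seq [RHS]big_seq; apply: eq_bigr => m' hm'.
rewrite mmapU /= rmorphM; under eq_bigr do rewrite mulrACA.
rewrite -mulr_sumr; congr (_ * _).
rewrite /entry_coef acM; case E: (ac m' J) => [H0|] /=; last first.
  by rewrite big1 // => H _; rewrite mulr0.
rewrite (bigD1_seq H0) //=; last exact: hS hm' E.
rewrite eqxx big1 => [|H nH]; last first.
  by rewrite (inj_eq Some_inj) [H0 == H]eq_sym (negbTE nH) mulr0.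
by rewrite addr0 chiM; case: ifP; rewrite ?mul0r.
Qed.

Definition targets (y : {malg K[M]}) (J : X) : seq X :=
  undup (pmap (fun m => ac m J) (msupp y)).

Lemma mem_targets y J m H : m \in msupp y -> ac m J = Some H -> H \in targets y J.
Proof.
by move=> hm e; rewrite mem_undup mem_pmap -e; apply: map_f.
Qed.

Lemma entry_neq0 y J H : entry J H y != 0 -> exists m, ac m J = Some H.
Proof.
move=> h; have [m hm] : exists m, entry_coef J H m != 0.
  apply/not_existsP => h0; case/eqP: h; rewrite /entry /mmap big1 // => m _.
  by have /negP := h0 m; rewrite negbK => /eqP->; rewrite mulr0.
exists m; move: hm; rewrite /entry_coef.
by case: (ac m J =P _) => // _; rewrite eqxx.
Qed.

Lemma entry_congr (eta : M -> M -> Prop) J I x :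
    (forall m m', eta m m' -> chi m = chi m' /\ ac m J = ac m' J) ->
  congr_ideal eta x -> entry J I x = 0.
Proof.
move=> he [r hr ->]; rewrite /entry raddf_sum big_seq big1 //= => -[c [m m']].
move/hr/he => /= [e1 e2]; rewrite scalerBr raddfB /= -!/(entry _ _ _) !entryZU.
by rewrite /entry_coef e1 e2 subrr.
Qed.

Variables (valid : pred X) (ideal : {malg K[M]} -> Prop).
Hypothesis ac_valid : forall m J I, ac m J = Some I -> valid J && valid I.
Hypothesis isolated : forall J (S : seq X), valid J -> S != [::] -> all valid S ->
  exists m H0, [/\ H0 \in S, ac m H0 = Some J &
    forall H, H \in S -> H != H0 -> ac m H = None].
Hypothesis valid_ex : exists J, valid J.
Hypothesis idealE : forall x, ideal x <-> forall J I, entry J I x = 0.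

Lemma partial_action_ideal : two_sided_ideal ideal.
Proof.
split=> [|x y /idealE hx /idealE hy|a x /idealE hx].
- by apply/idealE => J I; rewrite /entry raddf0.
- by apply/idealE => J I; rewrite /entry raddfB /= -!/(entry _ _ _) hx hy subr0.
split; apply/idealE => J I.
  rewrite (@entryM (targets x J)) ?undup_uniq //; last exact: mem_targets.
  by rewrite big1 // => H _; rewrite hx mulr0.
rewrite (@entryM (targets a J)) ?undup_uniq //; last exact: mem_targets.
by rewrite big1 // => H _; rewrite hx mul0r.
Qed.

Lemma partial_action_proper : ~ ideal 1.
Proof.
move=> /idealE h1; have [J vJ] := valid_ex.
have [|m [H [_ hm _]]] := isolated (S := [:: J]) vJ isT.
  by rewrite /= vJ.
have : entry H J << m >> = 0.
  rewrite -[<< m >>]mulr1 (@entryM (targets 1 H)) ?undup_uniq //.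
    by rewrite big1 // => H' _; rewrite h1 mulr0.
  exact: mem_targets.
by rewrite entryU /entry_coef hm eqxx => /eqP; rewrite (negbTE (chi_neq0 m)).
Qed.

Lemma partial_action_sandwich a b : ~ ideal a -> ~ ideal b ->
  exists m, ~ ideal (a * << m >> * b).
Proof.
move=> ha hb.
have nz x : ~ ideal x -> exists J I, entry J I x != 0.
  move=> hx; apply: contrapT => h; apply: hx; apply/idealE => J I.
  by apply/eqP/negPn/negP => hJI; apply: h; exists J, I.
have [J1 [I hI]] := nz _ ha; have [J0 [H1 hH1]] := nz _ hb.
pose S := [seq H <- targets b J0 | entry J0 H b != 0].
have vJ1 : valid J1 by have [m /ac_valid/andP[]] := entry_neq0 hI.
have hS : S != [::].
  apply/eqP => S0; have : H1 \in S; last by rewrite S0.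
  rewrite mem_filter hH1; move: hH1; rewrite {1}/entry /mmap => hH1.
  have [m hm e] : exists2 m, m \in msupp b & ac m J0 = Some H1.
    apply: contrapT => h; case/eqP: hH1; rewrite big_seq big1 // => m hm.
    rewrite /entry_coef; case: eqP => [e|_]; last by rewrite mulr0.
    by case: h; exists m.
  exact: mem_targets hm e.
have vS : all valid S.
  apply/allP => H; rewrite mem_filter => /andP[/entry_neq0[m /ac_valid/andP[]]] //.
have [t [H0 [H0S tH0 tH]]] := isolated vJ1 hS vS.
exists t; move/idealE/(_ J0 I)/eqP.
rewrite (@entryM (targets b J0)) ?undup_uniq //; last exact: mem_targets.
(* Column H of a t is [chi t] times the column of a at the image of H under t, and 0 if t kills
   H. *)
have at_entry H : entry H I (a * << t >>) =
    if ac t H is Some J then entry J I a * chi t else 0.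
  rewrite (@entryM (if ac t H is Some J then [:: J] else [::])).
  - case E: (ac t H) => [J|]; last by rewrite big_nil.
    by rewrite big_seq1 entryU /entry_coef E eqxx.
  - by case: (ac t H).
  move=> m J; rewrite msuppU1 inE => /eqP-> ->; exact: mem_head.
move: H0S; rewrite mem_filter => /andP[nz0 hH0].
(* Any other target either has a zero entry in b, by cancellation, or lies in S and is killed by
   t. *)
rewrite (bigD1_seq H0) ?undup_uniq //= big_seq_cond big1 ?addr0; last first.
  move=> H /andP[hH nH]; rewrite at_entry.
  have [->|nzH] := eqVneq (entry J0 H b) 0; first by rewrite mulr0.
  by rewrite tH ?mul0r // mem_filter nzH.
by rewrite at_entry tH0 !mulf_eq0 (negbTE hI) (negbTE nz0) (negbTE (chi_neq0 t)).
Qed.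

Lemma partial_action_prime : prime_ideal ideal.
Proof.
split; [exact: partial_action_ideal | exact: partial_action_proper |].
move=> A B hA hB hAB; apply: contrapT => /not_orP[/existsNP[a nA] /existsNP[b nB]].
have [Aa na] : A a /\ ~ ideal a by apply/not_implyP.
have [Bb nb] : B b /\ ~ ideal b by apply/not_implyP.
have [m []] := partial_action_sandwich na nb; apply: hAB => //.
by have [_ _ /(_ << m >> a Aa)[]] := hA.
Qed.

End PartialAction.

(** Subtracting from each m in the support a fixed representative of its class changes x only by the
    class sums of coefficients, which vanish. *)
Lemma congr_ideal_fiber (K : fieldType) (M : monomType) (eta : M -> M -> Prop)
    (x : {malg K[M]}) :
    (forall m, eta m m) -> (forall m m', eta m m' -> eta m' m) ->
    (forall m m' m'', eta m m' -> eta m' m'' -> eta m m'') ->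
    (forall m0, \sum_(m <- msupp x | `[< eta m m0 >]) mcoeff m x = 0) ->
  congr_ideal eta x.
Proof.
move=> eR eS eT h0.
(* [choose] depends only on the predicate, here the class of m, so congruent elements get the same
   representative. *)
pose rp m := choose (fun m' => `[< eta m' m >]) m.
have rpP m : eta (rp m) m.
  by apply/asboolP/(chooseP (P := fun m' => `[< eta m' m >]))/asboolP.
have rp_eq m m' : eta m m' -> rp m = rp m'.
  move=> e; rewrite /rp -(@eq_choose _ (fun k => `[< eta k m' >])).
    by apply: choose_id; apply/asboolP => //; apply: eR.
  by move=> k; apply/asboolP/asboolP => h; apply: eT h _ => //; apply: eS.
exists [seq (mcoeff m x, (m, rp m)) | m <- msupp x].
  by move=> _ /mapP[m _ ->] /=; apply: eS.
rewrite big_map /=; under eq_bigr do rewrite scalerBr.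
rewrite sumrB -[LHS]subr0; congr (_ - _).
  by rewrite {1}[x]monalgE; apply: eq_bigr => m _; rewrite malgU_scale.
symmetry; apply/malgP => k; rewrite raddf_sum mcoeff0 /=.
transitivity (\sum_(m <- msupp x | rp m == k) mcoeff m x).
  rewrite [RHS]big_mkcond; apply: eq_bigr => m _.
  by rewrite mcoeffZ mcoeffU1; case: eqP => _; rewrite ?mulr1 ?mulr0.
have [[m0 <-]|nk] := pselect (exists m0, rp m0 = k); last first.
  by rewrite big1 // => m /eqP e; case: nk; exists m.
rewrite -[RHS](h0 m0); apply: eq_bigl => m.
apply/eqP/asboolP => [e|/rp_eq//]; apply: eT (rpP m0).
by rewrite -e; apply: eS.
Qed.

(* The indicator of [arc_nf a w = (i, j)] is the difference of those of        *)
(* [w . j = i] and [w . (j - 1) = i - 1].                                      *)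
Lemma act_separates (V : zmodType) (T : Type) (r : seq T) (c : T -> V)
    (w : T -> seq nat) (A : seq (nat * nat)) (Q : pred T) (v : nat * nat -> bnf) :
    (forall J I, \sum_(m <- r | Q m && (act A (w m) J == Some I)) c m = 0) ->
  \sum_(m <- r | Q m && all (fun a => arc_nf a (w m) == v a) A) c m = 0.
Proof.
elim: A Q => [|a A IH] Q h.
  by rewrite -[RHS](h [::] [::]); apply: eq_bigl => m; rewrite /= eqxx.
transitivity (\sum_(m <- r | (Q m && (arc_nf a (w m) == v a)) &&
    all (fun a => arc_nf a (w m) == v a) A) c m).
  by apply: eq_bigl => m /=; rewrite andbA.
apply: IH => J I; case Ev: (v a) => [i j].
have h1 := h (j :: J) (i :: I).
rewrite (bigID (fun m => arc_nf a (w m) == (i, j))) /= in h1.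
have e1 : \sum_(m <- r | (Q m && (act (a :: A) (w m) (j :: J) == Some (i :: I))) &&
     (arc_nf a (w m) != (i, j))) c m = 0.
  (* If i or j is 0, only (i, j) itself sends e_j to e_i, and the remaining sum is empty. *)
  have [/andP[j0 i0]|ij0] := boolP ((0 < j)%N && (0 < i)%N); last first.
    rewrite big1 // => m; rewrite act_cons_eq bnf_act_exact.
    rewrite [(0 < j)%N && _]andbA (negbTE ij0) orbF.
    by case: (arc_nf a (w m) == _); rewrite ?andbF //= andbF.
  rewrite -[RHS](h (j.-1 :: J) (i.-1 :: I)); apply: eq_bigl => m.
  rewrite !act_cons_eq bnf_act_exact j0 i0 /=.
  have := @bnf_act_exact_disj (arc_nf a (w m)) i j; rewrite j0 i0 /=.
  case: (arc_nf a (w m) == (i, j)) => [/(_ isT)->|_]; last by rewrite andbT.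
  by rewrite !andbF.
rewrite -[RHS]h1 [X in _ = _ + X]e1 addr0; apply: eq_bigl => m.
rewrite -/(act (a :: A) (w m) (j :: J)) act_cons_eq bnf_act_exact.
by case: (arc_nf a (w m) == _); rewrite ?andbF //= !andbT.
Qed.
(** * The ideal of a leaf *)

Lemma same_data_act A k w w' : same_data A k w w' -> act A w =1 act A w'.
Proof.
case/andP=> + _; elim: A => [|a A IH] //= /andP[/eqP e /IH h] [|j J] //=.
by rewrite e h.
Qed.

Definition word n (m : chinese_monoid n) : seq nat := map val (repr m).

(** An exponent vector, so that the counts become a monomial in n variables. Variable i stands for
    the letter i + 1, and uncounted letters get exponent 0. *)
Definition multidegree n (d : diagram) (w : seq nat) : mpoly.multinom n :=
  mpoly.Multinom
    [tuple (if counted n d i.+1 then count_mem i.+1 w else 0%N) | i < n].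

Lemma multidegree_cat n d s t : multidegree n d (s ++ t) =
  mpoly.mnm_add (multidegree n d s) (multidegree n d t).
Proof.
apply/mpoly.mnmP => i; rewrite mpoly.mnmDE !mpoly.mnmE count_cat.
by case: ifP.
Qed.

Lemma multidegreeE n d A w w' : same_data A (counted_letters n d) w w' =
  (multidegree n d w == multidegree n d w') &&
  all (fun a => arc_nf a w == arc_nf a w') A.
Proof.
rewrite andbC; congr (_ && _); apply/allP/eqP => [h|/mpoly.mnmP h l].
  apply/mpoly.mnmP => i; rewrite !mpoly.mnmE; case: ifP => // hi.
  by apply/eqP/h; rewrite mem_filter hi mem_iota /=; have := ltn_ord i; lia.
rewrite mem_filter mem_iota => /andP[hc hl].
have hl' : (l.-1 < n)%N by lia.
have := h (Ordinal hl'); rewrite !mpoly.mnmE /=.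
have -> : l.-1.+1 = l by lia.
by rewrite hc => ->.
Qed.

Section Leaf.
Variables (K : fieldType) (n : nat) (d : diagram).
Hypothesis hd : leaf n d.

Local Notation M := (chinese_monoid n).
Local Notation R := (mpoly.mpoly n K).
Local Notation same := (same_data (arcs d) (counted_letters n d)).

(** [word] picks an arbitrary representative, so it is multiplicative only up to [same]. Weight and
    action depend on nothing finer. *)
Lemma word_pclass (s : pword (chinese_pres n)) : same (word (pclass s)) (map val s).
Proof. by apply/(rhoE _ _ hd); rewrite pclassK. Qed.

Lemma word_mul (x y : M) : same (word (mmul x y)) (word x ++ word y).
Proof. by rewrite -map_cat; apply: word_pclass. Qed.

Lemma rho_word (x y : M) : rho d x y <-> same (word x) (word y).
Proof. by rewrite -rhoE // !pclassK. Qed.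

Definition leaf_weight (m : M) : R :=
  mpoly.mpolyX K (multidegree n d (word m)).
Definition leaf_act (m : M) : seq nat -> option (seq nat) := act (arcs d) (word m).

Local Notation leaf_entry := (entry (@mpoly.mpolyC n K) leaf_weight leaf_act).

Lemma leaf_weightM (x y : M) :
  leaf_weight (mmul x y) = leaf_weight x * leaf_weight y.
Proof.
have := word_mul x y; rewrite multidegreeE => /andP[/eqP e _].
by rewrite /leaf_weight e multidegree_cat mpoly.mpolyXD.
Qed.

Lemma leaf_weight_neq0 (x : M) : leaf_weight x != 0.
Proof.
apply/eqP => /(congr1 (mpoly.mcoeff (multidegree n d (word x)))).
by rewrite mpoly.mcoeffX mpoly.mcoeff0 eqxx => /eqP; rewrite oner_eq0.
Qed.

Lemma leaf_actM (x y : M) J :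
  leaf_act (mmul x y) J = obind (leaf_act x) (leaf_act y J).
Proof. by rewrite /leaf_act (same_data_act (word_mul x y)) act_cat. Qed.

Lemma leaf_isolated J (S : seq (seq nat)) : size J == size (arcs d) ->
    S != [::] -> all (fun H => size H == size (arcs d)) S ->
  exists m H0, [/\ H0 \in S, leaf_act m H0 = Some J &
    forall H, H \in S -> H != H0 -> leaf_act m H = None].
Proof.
have [hv _] := hd => /eqP hJ hS hsz.
have [w [H0 [hw H0S wH0 wH]]] := isolate (nested_arcs hv) hJ hS hsz.
have [s es] : exists s : pword (chinese_pres n), map val s = w.
  have : all (pgen (chinese_pres n)) w.
    by apply/allP => l /(allP hw) /(arc_ends_range hv).
  elim: (w) => [|l w' IH] /=; first by exists [::].
  by case/andP=> hl /IH[s <-]; exists (exist _ l hl :: s).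
have e : leaf_act (pclass s) =1 act (arcs d) w.
  by rewrite -es; apply: same_data_act (word_pclass s).
exists (pclass s), H0; split=> // [|H HS nH]; rewrite e //.
exact: wH.
Qed.

(** For the converse, a coefficient of an entry polynomial fixes the multidegree and [act_separates]
    fixes the normal forms at all arcs, so the coefficients of x sum to 0 over each class. *)
Lemma leaf_idealE (x : {malg K[M]}) :
  congr_ideal (@rho n d) x <-> forall J I, leaf_entry J I x = 0.
Proof.
split=> [hx J I|h].
  apply: entry_congr hx => m m' /rho_word hmm'; split.
    rewrite /leaf_weight; congr mpoly.mpolyX.
    by move: hmm'; rewrite multidegreeE => /andP[/eqP].
  exact: same_data_act hmm' J.
apply: congr_ideal_fiber => [m|m m'|m m' m''|m0]; rewrite ?/rho //.
  by move=> ->.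
transitivity (\sum_(m <- msupp x |
    (multidegree n d (word m) == multidegree n d (word m0)) &&
    all (fun a => arc_nf a (word m) == arc_nf a (word m0)) (arcs d)) mcoeff m x).
  apply: eq_bigl => m; rewrite -multidegreeE.
  by apply/asboolP/idP => /rho_word.
apply: act_separates => J I.
have := congr1 (mpoly.mcoeff (multidegree n d (word m0))) (h J I).
rewrite /entry /mmap raddf_sum mpoly.mcoeff0 => {2}<-.
rewrite big_mkcond; apply: eq_bigr => m _ /=.
rewrite mpoly.mcoeffCM /entry_coef /leaf_act /leaf_weight.
case: (act _ _ J == _); last by rewrite andbF mpoly.mcoeff0 mulr0.
by rewrite mpoly.mcoeffX andbT; case: eqP; rewrite ?mulr1 ?mulr0.
Qed.

End Leaf.

Theorem theorem2p2p12 (K : fieldType) (n : nat) (hn : (3 <= n)%N)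
    (d : diagram) (hd : leaf n d) :
  prime_ideal (@congr_ideal K (chinese_monoid n) (@rho n d)).
Proof.
pose valid (J : seq nat) := size J == size (arcs d).
apply: (@partial_action_prime K (mpoly.mpoly n K) (chinese_monoid n) (seq nat)
  (@mpoly.mpolyC n K) (leaf_weight K d) (@leaf_act n d) (leaf_weightM K hd)
  (leaf_weight_neq0 K d) (leaf_actM hd) valid).
- by move=> m J I /act_size[hJ hI]; rewrite /valid hJ hI eqxx.
- by move=> J S; apply: leaf_isolated hd J S.
- by exists (nseq (size (arcs d)) 0%N); rewrite /valid size_nseq.
- exact: leaf_idealE.
Qed.
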